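(* Suppose $\mu:=\mathbb{E}[\xi]\in(0,\infty)$. The following assertions are equivalent: (W1) $\lim_{t\to\infty}t^{-1}\tau(t)=\mu^{-1}$ in probability; (W2) $\lim_{n\to\infty}n^{-1}\max_{1\le k\le n}T_k=\mu$ in probability; (W3) $\lim_{t\to\infty}t\,\mathbb{P}\{\eta>t\}=0$.
   Context: Let $(\xi_1,\eta_1),(\xi_2,\eta_2),\ldots$ be independent copies of an $\mathbb{R}^2$-valued random vector $(\xi,\eta)$ with arbitrarily dependent components. Put $S_0:=0$, $S_n:=\xi_1+\ldots+\xi_n$ for $n\in\mathbb{N}=\{1,2,\ldots\}$, and $T_n:=S_{n-1}+\eta_n$ for $n\in\mathbb{N}$ (the globally perturbed random walk). For $t\in\mathbb{R}$ define the first passage time $\tau(t):=\inf\{n\ge 1: T_n>t\}$, with the convention $\inf\varnothing=\infty$. *)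

(* Defs.v *)
From HB Require Import structures.
From mathcomp Require Import all_boot all_order all_algebra finmap.
From mathcomp Require Import all_classical all_reals all_analysis.

Set Implicit Arguments.
Unset Strict Implicit.
Unset Printing Implicit Defensive.

Import Order.TTheory GRing.Theory Num.Theory.
Import numFieldNormedType.Exports.

Local Open Scope classical_set_scope.
Local Open Scope ring_scope.

Section Probability.
Context (d d' : measure_display) (T : measurableType d) (T' : measurableType d')
  (R : realType) (P : probability T R).

(* The values of [P] on non-measurable sets are unspecified, hence the
   restriction to measurable sets in this definition and the next one. *)
Definition same_distribution (X Y : T -> T') : Prop :=
  forall B : set T', measurable B -> P (X @^-1` B) = P (Y @^-1` B).

Definition mutually_independent (I : choiceType) (X : I -> T -> T') : Prop :=
  forall (J : {fset I}) (B : I -> set T'),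
    (forall j, j \in J -> measurable (B j)) ->
    P (\bigcap_(j in [set` J]) (X j @^-1` B j)) =
    (\prod_(j <- J) P (X j @^-1` B j))%E.

Definition independent_copies (X : nat -> T -> T') (X0 : T -> T') : Prop :=
  mutually_independent X /\ forall k, same_distribution (X k) X0.

(* Convergence in probability, along a filter, of extended-real-valued
   functions to an everywhere finite limit. *)
Definition cvg_in_probability (I : Type) (F : set_system I)
    (X : I -> T -> \bar R) (Y : T -> R) : Prop :=
  forall eps : R, 0 < eps ->
    P [set w | (eps%:E < `|X i w - (Y w)%:E|)%E] @[i --> F] --> 0%E.

End Probability.

(* The step sequences are indexed from 0 : [xi_ k] and [eta_ k] stand for
   xi_(k+1) and eta_(k+1). The indices of [walk], [perturbed_walk] and
   [running_max] are not shifted; the last two are meaningful from index 1. *)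
Section PerturbedRandomWalk.
Context (T : Type) (R : realType) (xi_ eta_ : nat -> T -> R).

Definition walk (n : nat) (w : T) : R := \sum_(0 <= k < n) xi_ k w.

Definition perturbed_walk (n : nat) (w : T) : R :=
  walk n.-1 w + eta_ n.-1 w.

(* [ereal_inf set0 = +oo] *)
Definition first_passage (t : R) (w : T) : \bar R :=
  ereal_inf [set (n%:R : R)%:E | n in
               [set n | (1 <= n)%N /\ t < perturbed_walk n w]].

Definition running_max (n : nat) (w : T) : R :=
  \big[Num.max/perturbed_walk 1 w]_(1 <= k < n.+1) perturbed_walk k w.

End PerturbedRandomWalk.

(* Main.v *)
Require Import Defs.
From HB Require Import structures.
From mathcomp Require Import all_boot all_order all_algebra finmap.
From mathcomp Require Import all_classical all_reals all_analysis.
From mathcomp Require Import measurable_realfun.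
From mathcomp Require Import ring lra.

(** Write [S_k] for the walk, [T_k] for its perturbation and [M_n] for the
running maximum of the [T_k]. The argument goes around the circle
(W3) => (W2) => (W1) => [P(M_n > 3 mu n) -> 0] => (W3).

The first and the last step rest on a maximal weak law of large numbers
([maximal_law_of_large_numbers]): for every [eps > 0], with probability tending
to 1, [|S_k - k mu| <= eps n] simultaneously for all [k <= n]. Only integrability
of [xi] is available, so [xi] is clamped at levels [- c] and [c]. The clamped, centred
summands are bounded and uncorrelated, hence Chebyshev's inequality controls
their walk on a grid of [K] times, [K] not depending on [n]; between two grid
times a walk with bounded steps moves by at most [O(n / K)]. The remainders are
small in L1, and the sum of their absolute values, which dominates all
partial sums at once, is handled by Markov's inequality.

(W3) => (W2) ([running_max_law]): by the union bound
[P(max_(k <= n) eta_k > a n) <= n P(eta > a n) -> 0], so the perturbations cannot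
lift [M_n] above [(mu + eps) n]; and [M_n >= T_n] gives the lower bound, because
[eta_n / n -> 0] in probability from below.

(W2) => (W1) ([first_passage_law]): the events [tau(t) > n] and [M_n <= t]
coincide, so a deviation of [tau(t) / t] from [1 / mu] is a deviation of [M_n / n]
from [mu] for [n] close to [(1 / mu + eps) t] or to [(1 / mu - eps) t].

(W1) => (W3): if [tau(3 mu n) > n] with high probability then [M_n <= 3 mu n], and
since [S_k >= - mu n] for all [k <= n] with high probability, no [eta_k] with
[k <= n] exceeds [4 mu n]. By independence this says [(1 - p_n)^n -> 1] for
[p_n = P(eta > 4 mu n)], which forces [n p_n -> 0] by Bernoulli's inequality
([tail_of_running_max_bound]). *)

Set Implicit Arguments.
Unset Strict Implicit.
Unset Printing Implicit Defensive.

Import Order.TTheory GRing.Theory Num.Theory.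
Import numFieldNormedType.Exports.

Local Open Scope classical_set_scope.
Local Open Scope ring_scope.

(** * Vanishing probabilities and moment inequalities *)

(** Lets convergence of probabilities be argued with real error bounds, without
proving finiteness each time. *)
Lemma nneg_cvge0P (R : realType) (I : Type) (F : set_system I) {FF : Filter F}
    (u : I -> \bar R) : (\forall i \near F, 0 <= u i)%E ->
  (u i @[i --> F] --> 0%E) <->
  (forall e : R, 0 < e -> \forall i \near F, (u i <= e%:E)%E).
Proof.
move=> u_ge0.
split=> [/fine_cvgP[ufin /cvgrPdist_le u0] e e0|u0].
  near=> i.
  have ui : u i \is a fin_num by near: i.
  rewrite -(fineK ui) lee_fin -[leLHS]ger0_norm ?fine_ge0//; last by near: i.
  by rewrite -normrN -[X in `|X|]sub0r; near: i; exact: u0.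
apply/fine_cvgP; split.
  near=> i; rewrite ge0_fin_numE; last by near: i.
  apply: (@le_lt_trans _ _ 1%:E).
    by near: i; exact: u0.
  exact: ltry.
apply/cvgrPdist_le => e e0; near=> i.
have ui0 : (0 <= u i)%E by near: i.
have uie : (u i <= e%:E)%E by near: i; exact: u0.
rewrite sub0r normrN ger0_norm ?fine_ge0//= -lee_fin fineK//.
by rewrite ge0_fin_numE//; exact: le_lt_trans uie (ltry _).
Unshelve. all: by end_near. Qed.

Section vanishing_probability.
Context d (T : measurableType d) (R : realType) (P : probability T R)
  (I : Type) (F : set_system I) {FF : Filter F}.
Implicit Types A B : I -> set T.

Lemma probability_cvg0_subset A B :
    (forall i, measurable (A i)) -> (forall i, measurable (B i)) ->
    (\forall i \near F, A i `<=` B i) ->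
  P (B i) @[i --> F] --> 0%E -> P (A i) @[i --> F] --> 0%E.
Proof.
move=> mA mB AB PB; apply: (squeeze_cvge _ _ PB); last exact: cvg_cst.
near=> i; rewrite measure_ge0/= le_measure ?inE//.
by near: i.
Unshelve. all: by end_near. Qed.

Lemma probability_cvg0_setU A B :
    (forall i, measurable (A i)) -> (forall i, measurable (B i)) ->
    P (A i) @[i --> F] --> 0%E -> P (B i) @[i --> F] --> 0%E ->
  P (A i `|` B i) @[i --> F] --> 0%E.
Proof.
move=> mA mB PA PB.
have PAB : (P (A i) + P (B i))%E @[i --> F] --> 0%E.
  by rewrite -[X in _ --> X](adde0 0%E); apply: cvgeD.
apply: (squeeze_cvge _ _ PAB); last exact: cvg_cst.
by near=> i; rewrite measure_ge0/= measureU2.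
Unshelve. all: by end_near. Qed.

End vanishing_probability.

Section moments.
Context d (T : measurableType d) (R : realType) (P : probability T R).

Lemma bounded_integrable (f : T -> R) (c : R) :
    measurable_fun setT f -> (forall x, `|f x| <= c) ->
  P.-integrable setT (EFin \o f).
Proof.
move=> mf fc; apply: measurable_bounded_integrable => //.
  by rewrite -ge0_fin_numE// fin_num_measure.
exists c; split; first exact: num_real.
by move=> y cy x _; exact: le_trans (fc x) (ltW cy).
Qed.

Lemma markov_ge0 (f : T -> R) (a : R) : measurable_fun setT f ->
    (forall x, 0 <= f x) -> 0 < a ->
  (P [set x | (a < f x)%R] <= a^-1%:E * \int[P]_x (f x)%:E)%E.
Proof.
move=> mf f0 a0.
have mEf : measurable_fun setT (EFin \o f) by exact/measurable_EFinP.
have := le_integral_abse P measurableT mEf a0.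
have -> : (\int[P]_x `|(EFin \o f) x|)%E = (\int[P]_x (f x)%:E)%E.
  by apply: eq_integral => x _; rewrite /= ger0_norm.
rewrite setTI => h; rewrite lee_pdivlMl//.
apply: le_trans h; rewrite lee_pmul2l//; apply: le_measure; rewrite ?inE.
- rewrite -[X in measurable X]setTI -preimage_itvoy; exact: mf.
- rewrite -[X in measurable X]setTI; apply: emeasurable_fun_c_infty => //.
  by exact: measurableT_comp.
- by move=> x /= /ltW; rewrite lee_fin => h; apply: le_trans h (ler_norm _).
Qed.

(** Unlike the variance form, this needs no exact centring and only an upper
bound on the second moment. *)
Lemma chebyshev_second_moment (f : T -> R) (a b : R) : measurable_fun setT f ->
    (\int[P]_x (f x ^+ 2)%:E <= b%:E)%E -> 0 < a ->
  (P [set x | (a < `|f x|)%R] <= (a ^- 2 * b)%:E)%E.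
Proof.
move=> mf fb a0.
have -> : [set x | a < `|f x|] = [set x | a ^+ 2 < f x ^+ 2].
  apply/seteqP; split=> x /=; rewrite -[f x ^+ 2]real_normK ?num_real//;
    by rewrite ltr_pXn2r// ?nnegrE ?(ltW a0) ?normr_ge0.
rewrite EFinM; apply: le_trans (markov_ge0 _ _ _) _ => //.
- exact: measurable_funX.
- by move=> x; exact: sqr_ge0.
- exact: exprn_gt0.
- by rewrite lee_pmul2l// lte_fin invr_gt0 exprn_gt0.
Qed.

End moments.

(** * Transfer along distributions and independence *)

Section independence.
Context d (T : measurableType d) (R : realType) (P : probability T R).

Lemma integral_same_distribution (X Y : {RV P >-> R}) (f : R -> R) :
    same_distribution P X Y -> measurable_fun setT f ->
    P.-integrable setT (EFin \o f \o X) -> P.-integrable setT (EFin \o f \o Y) ->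
  (\int[P]_w (f (X w))%:E = \int[P]_w (f (Y w))%:E)%E.
Proof.
move=> XY mf fX fY.
have mEf : measurable_fun setT (EFin \o f) by exact/measurable_EFinP.
rewrite -(integral_distribution mEf fX) -(integral_distribution mEf fY).
by apply: eq_measure_integral => A mA _; exact: XY.
Qed.

(** The product rule on rectangles identifies the joint law with the product
of the marginal laws, so Fubini applies: the inner integral is a multiple of
the mean of [f] under the law of [Y], which vanishes. *)
Lemma integralM_independent_eq0 (X Y : {RV P >-> R}) (f : R -> R) (c : R) :
    (forall A B : set R, measurable A -> measurable B ->
      P (X @^-1` A `&` Y @^-1` B) = (P (X @^-1` A) * P (Y @^-1` B))%E) ->
    measurable_fun setT f -> (forall x, `|f x| <= c) ->
    (\int[P]_w (f (Y w))%:E = 0)%E ->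
  (\int[P]_w (f (X w) * f (Y w))%:E = 0)%E.
Proof.
move=> XY mf fc fY0.
pose Z w := (X w, Y w).
have mZ : measurable_fun setT Z by exact/measurable_fun_pair.
pose Z' : {RV P >-> (R * R)%type} := mfun_Sub (mem_set mZ).
pose g (z : R * R) := f z.1 * f z.2.
have mg : measurable_fun setT g.
  by apply: measurable_funM; apply: measurableT_comp => //.
have gc z : `|g z| <= c * c by rewrite normrM ler_pM.
have mEg : measurable_fun setT (EFin \o g) by exact/measurable_EFinP.
have mEf : measurable_fun setT (EFin \o f) by exact/measurable_EFinP.
transitivity (\int[distribution P Z']_z (g z)%:E)%E.
  rewrite (@integral_distribution _ _ _ _ _ P Z' (EFin \o g))//.
  apply: (@bounded_integrable _ _ _ _ (g \o Z') (c * c)).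
    exact: measurableT_comp.
  by move=> w; exact: gc.
transitivity (\int[distribution P X \x distribution P Y]_z (g z)%:E)%E.
  apply: eq_measure_integral => A mA _; apply/esym.
  by apply: product_measure_unique => // B C mB mC; rewrite -XY.
rewrite -(@integral12_prod_meas1 _ _ _ _ _ _ _ (EFin \o g)).
  apply: integral0_eq => x _; rewrite /fubini_F /=.
  under eq_integral do rewrite /g /= EFinM.
  rewrite integralZl//; last exact: bounded_integrable fc.
  rewrite (@integral_distribution _ _ _ _ _ P Y (EFin \o f))//.
    by rewrite [X in (_ * X)%E]fY0 mule0.
  apply: (@bounded_integrable _ _ _ _ (f \o Y) c).
    exact: measurableT_comp.
  by move=> w; exact: fc.
exact: bounded_integrable gc.
Qed.

End independence.

(** * The maximal law of large numbers for bounded uncorrelated steps *)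

Section maximal_deviation.
Context d (T : measurableType d) (R : realType) (P : probability T R).

Definition max_exceeds (W : nat -> T -> R) (a : R) (n : nat) : set T :=
  [set w | exists2 k, (k <= n)%N & a < `|W k w|].

Lemma measurable_norm_gt (f : T -> R) (a : R) : measurable_fun setT f ->
  measurable [set w | a < `|f w|].
Proof.
move=> mf; rewrite -[X in measurable X]setTI.
have mnf : measurable_fun setT (fun w => `|f w|) by exact: measurableT_comp.
by rewrite -[X in _ `&` X]preimage_itvoy; exact: mnf.
Qed.

Lemma measurable_gt (f : T -> R) (a : R) : measurable_fun setT f ->
  measurable [set w | a < f w].
Proof.
by move=> mf; rewrite -[X in measurable X]setTI -preimage_itvoy; exact: mf.
Qed.

(** The event is, by conversion, a union indexed by the [k] with [k <= n]. *)
Lemma measurable_max_exceeds (W : nat -> T -> R) a n :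
  (forall k, measurable_fun setT (W k)) -> measurable (max_exceeds W a n).
Proof.
move=> mW.
apply: (@bigcup_measurable _ _ (fun k => [set w | a < `|W k w|]) [set k | (k <= n)%N]).
by move=> k _; exact: measurable_norm_gt.
Qed.

Lemma measurable_walk (Z : nat -> T -> R) k :
  (forall i, measurable_fun setT (Z i)) -> measurable_fun setT (walk Z k).
Proof. by move=> mZ; apply: measurable_sum. Qed.

(** Expanding the square, only the diagonal terms survive. *)
Lemma walk_second_moment (Z : nat -> T -> R) (c : R) (k : nat) :
    (forall i, measurable_fun setT (Z i)) -> (forall i w, `|Z i w| <= c) ->
    (forall i j, i != j -> \int[P]_w (Z i w * Z j w)%:E = 0)%E ->
  (\int[P]_w (walk Z k w ^+ 2)%:E <= (k%:R * c ^+ 2)%:E)%E.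
Proof.
move=> mZ Zc Zorth.
have ZZc i j w : `|Z i w * Z j w| <= c * c by rewrite normrM ler_pM.
have iZZ i j : P.-integrable setT (fun w => (Z i w * Z j w)%:E).
  by apply: bounded_integrable (ZZc i j); exact: measurable_funM.
under eq_integral.
  move=> w _; rewrite expr2 /walk mulr_suml -sumEFin.
  under eq_bigr do rewrite mulr_sumr -sumEFin.
  over.
rewrite integral_sum//; last by move=> i; exact: integrable_sum.
apply: (@le_trans _ _ (\sum_(0 <= i < k) (c ^+ 2)%:E)%E); last first.
  by rewrite sumEFin big_const_nat subn0 iter_addr_0 mulr_natl.
rewrite big_nat [leRHS]big_nat; apply: lee_sum => i ik.
rewrite integral_sum//.
rewrite (bigD1_seq i) ?mem_index_iota ?iota_uniq//=.
rewrite [X in (_ + X)%E]big1 ?adde0; last first.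
  by move=> j ji; rewrite Zorth// eq_sym.
have -> : ((c ^+ 2)%:E = \int[P]_w (c ^+ 2)%:E)%E.
  by rewrite integral_cst//= probability_setT mule1.
apply: le_integral => //.
  by apply: (@bounded_integrable _ _ _ _ (cst (c ^+ 2)) `|c ^+ 2|).
by move=> w _; rewrite lee_fin expr2; exact: le_trans (ler_norm _) (ZZc i i w).
Qed.

Lemma walk_increment (Z : nat -> T -> R) (c : R) (j r : nat) (w : T) :
  (forall i, `|Z i w| <= c) -> `|walk Z (j + r) w - walk Z j w| <= r%:R * c.
Proof.
move=> Zc; rewrite /walk (@big_cat_nat _ _ _ j)//= ?leq_addr// addrAC subrr add0r.
apply: le_trans (ler_norm_sum _ _ _) _.
apply: (@le_trans _ _ (\sum_(j <= i < j + r) c)); first exact: ler_sum.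
by rewrite big_const_nat addKn iter_addr_0 mulr_natl.
Qed.

(** A union bound over all [k <= n] would lose: Chebyshev's inequality only bounds
each event by a multiple of [1 / n]. It suffices however to control the walk at [K] equally spaced
times, with [K] independent of [n]: steps bounded by [c] let it move by at most
[c n / K <= eps n / 2] between two of them. *)
Lemma bounded_maximal_law (Z : nat -> T -> R) (c eps : R) :
    (forall i, measurable_fun setT (Z i)) -> (forall i w, `|Z i w| <= c) ->
    (forall i j, i != j -> \int[P]_w (Z i w * Z j w)%:E = 0)%E ->
    0 < eps ->
  P (max_exceeds (walk Z) (eps * n%:R) n) @[n --> \oo] --> 0%E.
Proof.
move=> mZ Zc Zorth eps0.
have mW k : measurable_fun setT (walk Z k) by exact: measurable_walk.
have [w0 _] : [set: T] !=set0.
  apply/set0P/eqP => T0; have := probability_setT P.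
  by rewrite T0 measure0 => /eqP; rewrite eqe eq_sym oner_eq0.
have c0 : 0 <= c := le_trans (normr_ge0 _) (Zc 0%N w0).
pose K := (Num.truncn (2 * c / eps)).+1.
have K0 : (0 : R) < K%:R by rewrite ltr0n.
have cK : c / K%:R <= eps / 2.
  have : 2 * c / eps < K%:R by exact: truncnS_gt.
  by rewrite ltr_pdivrMr// ler_pdivrMr// => cK; lra.
(* Capping the grid times at [n] keeps the second moment below [n c^2] even
   for the last ones, which may exceed [n]. *)
pose B n j := [set w | eps / 2 * n%:R < `|walk Z (minn j n) w|].
have mB n j : measurable (B n j) by exact: measurable_norm_gt.
apply/nneg_cvge0P => [|e e0]; first by apply: nearW => n; exact: measure_ge0.
near=> n.
have n0 : (0 : R) < n%:R by rewrite ltr0n; near: n; exists 1%N.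
pose m := (n %/ K).+1.
have sub : max_exceeds (walk Z) (eps * n%:R) n `<=`
    \big[setU/set0]_(j < K) B n (j * m)%N.
  move=> w [k kn Wk]; rewrite -(bigcup_mkord K (fun j => B n (j * m)%N)).
  have jK : (k %/ m < K)%N.
    by rewrite ltn_divLR// (leq_ltn_trans kn)// mulnC ltn_ceil.
  exists (k %/ m)%N => //=; rewrite /B /=.
  have jk : (k %/ m * m <= k)%N by exact: leq_divM.
  rewrite (minn_idPl (leq_trans jk kn)).
  have := @walk_increment Z c (k %/ m * m) (k %% m) w (Zc ^~ w).
  rewrite -divn_eq => incr.
  have r_le : (k %% m)%:R * c <= eps / 2 * n%:R.
    have : ((k %% m)%:R : R) <= n%:R / K%:R.
      rewrite ler_pdivlMr// -natrM ler_nat.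
      have : (k %% m <= n %/ K)%N by rewrite -ltnS ltn_mod.
      by move=> h; rewrite (leq_trans _ (leq_divM n K))// leq_mul2r h orbT.
    move=> /(ler_wpM2r c0) /le_trans; apply.
    by rewrite mulrAC -mulrA mulrC ler_pM2r.
  have := ler_normB (walk Z k w) (walk Z (k %/ m * m) w).
  have := lerB_dist (walk Z k w) (walk Z (k %/ m * m) w).
  lra.
apply: le_trans (@content_subadditive _ _ _ P _ (fun j => B n (j * m)%N) K _ _ sub) _.
- by move=> j _; exact: mB.
- by apply: measurable_max_exceeds.
apply: (@le_trans _ _ (\sum_(j < K) ((eps / 2 * n%:R) ^- 2 * (n%:R * c ^+ 2))%:E)%E).
  apply: lee_sum => j _; apply: chebyshev_second_moment => //.
    apply: le_trans (walk_second_moment _ mZ Zc Zorth) _.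
    by rewrite lee_fin ler_wpM2r ?sqr_ge0// ler_nat geq_minr.
  by rewrite mulr_gt0// divr_gt0.
rewrite sumEFin lee_fin sumr_const card_ord -[leLHS]mulr_natr.
have -> : (eps / 2 * n%:R) ^- 2 * (n%:R * c ^+ 2) * K%:R =
    (4 * c ^+ 2 * K%:R / eps ^+ 2) / n%:R.
  by field; rewrite !gt_eqF.
rewrite ler_pdivrMr// -ler_pdivrMl//.
near: n; exact: nbhs_infty_ger.
Unshelve. all: by end_near. Qed.

End maximal_deviation.

(** * The maximal law of large numbers for integrable steps *)

Section truncation.
Context (R : realType).

Definition clamp (c x : R) : R := Num.max (- c) (Num.min c x).

Lemma measurable_clamp c : measurable_fun setT (clamp c).
Proof. by apply: measurable_maxr => //; exact: measurable_minr. Qed.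

Lemma norm_clamp c x : 0 <= c -> `|clamp c x| <= c.
Proof.
move=> c0; rewrite /clamp ler_norml le_max lexx/= ge_max ge_min lexx/= andbT.
by rewrite ge0_cp.
Qed.

Lemma clamp_id c x : `|x| <= c -> clamp c x = x.
Proof. by rewrite ler_norml => /andP[cx xc]; rewrite /clamp min_r// max_r. Qed.

Lemma norm_clamp_le c x : 0 <= c -> `|clamp c x| <= `|x|.
Proof.
move=> c0; have [xc|cx] := leP `|x| c; first by rewrite clamp_id.
exact: le_trans (norm_clamp x c0) (ltW cx).
Qed.

(** Dominated convergence along integer levels, [|X|] being the bound. *)
Lemma clamp_cvg_L1 d (T : measurableType d) (P : probability T R)
    (X : {RV P >-> R}) (delta : R) :
    P.-integrable setT (EFin \o X) -> 0 < delta ->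
  exists2 c : R, 0 <= c &
    (\int[P]_w `|clamp c (X w) - X w|%:E <= delta%:E)%E.
Proof.
move=> iX delta0.
pose f_ (n : nat) w := (clamp n%:R (X w))%:E.
have mf n : measurable_fun setT (f_ n).
  apply/measurable_EFinP; apply: measurableT_comp => //.
  exact: measurable_clamp.
have mX : measurable_fun setT (EFin \o X) by exact/measurable_EFinP.
have f_cvg : {ae P, forall w, setT w -> f_ ^~ w @ \oo --> (EFin \o X) w}.
  apply: aeW => w _; apply: cvg_near_cst; near=> n.
  rewrite /f_ clamp_id//; near: n; exact: nbhs_infty_ger.
have f_dom : {ae P, forall w n, setT w -> (`|f_ n w| <= (abse \o (EFin \o X)) w)%E}.
  by apply: aeW => w n _; rewrite /= lee_fin norm_clamp_le.
have [_ + _] := dominated_convergence measurableT mf mX f_cvg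
  (integrable_abse iX) f_dom.
move=> /nneg_cvge0P /(_ _ delta0)[|N _ /(_ N (leqnn N)) hN].
  by apply: nearW => n; apply: integral_ge0.
by exists N%:R.
Unshelve. all: by end_near. Qed.

End truncation.

Section maximal_law.
Context d (T : measurableType d) (R : realType) (P : probability T R).

(** With [V_i] the clamped and centred steps and [m] the clamped mean,
[S_k - k mu = sum_(i < k) V_i - sum_(i < k) (clamp X_i - X_i) + k (m - mu)].
The first sum obeys the bounded law; the second is dominated, uniformly in
[k <= n], by a sum of nonnegative terms of mean at most [n delta]; the last term
is at most [n delta]. The law is needed along the whole path, not only at time
[n], because the maximum of the perturbed walk sees all of it. *)
Lemma maximal_law_of_large_numbers (X_ : nat -> {RV P >-> R})
    (X : {RV P >-> R}) (mu eps : R) :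
    (forall i j, i != j -> forall A B : set R, measurable A -> measurable B ->
      P (X_ i @^-1` A `&` X_ j @^-1` B) =
      (P (X_ i @^-1` A) * P (X_ j @^-1` B))%E) ->
    (forall i, same_distribution P (X_ i) X) ->
    P.-integrable setT (EFin \o X) -> (\int[P]_w (X w)%:E = mu%:E)%E ->
    0 < eps ->
  P (max_exceeds (fun k w => walk X_ k w - k%:R * mu) (eps * n%:R) n)
    @[n --> \oo] --> 0%E.
Proof.
move=> Xindep Xid iX EX eps0.
have mW k : measurable_fun setT (walk X_ k) by exact: measurable_walk.
apply/nneg_cvge0P => [|e e0]; first by apply: nearW => n; exact: measure_ge0.
(* [eps / 4] bounds the bias [k (m - mu)], and [e eps / 8] makes Markov's bound
   [4 delta / eps] at most [e / 2]. *)
pose delta := Num.min (eps / 4) (e * eps / 8).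
have delta0 : 0 < delta by rewrite lt_min !divr_gt0// mulr_gt0.
have [c c0 cX] := clamp_cvg_L1 iX delta0.
have icX (Y : {RV P >-> R}) : P.-integrable setT (EFin \o clamp c \o Y).
  apply: (@bounded_integrable _ _ _ _ (clamp c \o Y) c).
    by apply: measurableT_comp => //; exact: measurable_clamp.
  by move=> w; exact: norm_clamp.
pose m := fine (\int[P]_w (clamp c (X w))%:E).
have Em : (\int[P]_w (clamp c (X w))%:E = m%:E)%E.
  by rewrite fineK// integrable_fin_num// icX.
have m_mu : `|m - mu| <= delta.
  rewrite -lee_fin; apply: le_trans cX.
  rewrite -abse_EFin EFinB -Em -EX -integralB_EFin//; last exact: icX.
  apply: (le_trans (le_abse_integral _ _ _)) => //.
  apply: measurable_int (integrableB _ (icX X) iX) => //.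
pose f x := clamp c x - m.
have mf : measurable_fun setT f.
  by apply: measurable_funB => //; exact: measurable_clamp.
have fb x : `|f x| <= c + `|m|.
  by rewrite (le_trans (ler_normB _ _))// lerD2r norm_clamp.
have if_ (Y : {RV P >-> R}) : P.-integrable setT (EFin \o f \o Y).
  apply: (@bounded_integrable _ _ _ _ (f \o Y) (c + `|m|)).
    exact: measurableT_comp.
  by move=> w; exact: fb.
have Ef0 i : (\int[P]_w (f (X_ i w))%:E = 0)%E.
  rewrite (integral_same_distribution (Xid i) mf)//.
  rewrite /f; under eq_integral do rewrite EFinB.
  rewrite integralB//; [|exact: icX|exact: finite_measure_integrable_cst].
  by rewrite Em integral_cst//= probability_setT mule1 subee.
pose V i w := f (X_ i w).
have mV i : measurable_fun setT (V i) by exact: measurableT_comp.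
have V_small : P (max_exceeds (walk V) (eps / 2 * n%:R) n) @[n --> \oo] --> 0%E.
  apply: (@bounded_maximal_law _ _ _ _ V (c + `|m|)) => //.
  - by move=> i w; exact: fb.
  - move=> i j ij; apply: (integralM_independent_eq0 _ mf fb (Ef0 j)).
    exact: Xindep.
  - exact: divr_gt0.
pose h (x : R) : R := `|clamp c x - x|.
have mh : measurable_fun setT h.
  apply: measurableT_comp => //; apply: measurable_funB => //.
  exact: measurable_clamp.
pose H n w := \sum_(0 <= i < n) h (X_ i w).
have mH n : measurable_fun setT (H n).
  by apply: measurable_sum => i; exact: measurableT_comp.
have EH n : (\int[P]_w (H n w)%:E <= (n%:R * delta)%:E)%E.
  rewrite /H; under eq_integral do rewrite -sumEFin.
  rewrite ge0_integral_sum//; last 2 first.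
    by move=> i; apply/measurable_EFinP; exact: measurableT_comp.
    by move=> i w _; rewrite lee_fin; exact: normr_ge0.
  apply: (@le_trans _ _ (\sum_(0 <= i < n) delta%:E)%E); last first.
    by rewrite sumEFin big_const_nat subn0 iter_addr_0 mulr_natl.
  apply: lee_sum => i _.
  have mEh : measurable_fun setT (EFin \o h) by exact/measurable_EFinP.
  rewrite -(@ge0_integral_distribution _ _ _ _ _ P (X_ i) (EFin \o h))//;
    last by move=> x; rewrite lee_fin; exact: normr_ge0.
  rewrite (@eq_measure_integral _ _ _ _ (distribution P X)); last first.
    by move=> A mA _; exact: Xid.
  rewrite ge0_integral_distribution//.
  by move=> x; rewrite lee_fin; exact: normr_ge0.
have e20 : 0 < e / 2 by exact: divr_gt0.
have [|N _ VN] := (nneg_cvge0P _).1 V_small _ e20.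
  by apply: nearW => n; exact: measure_ge0.
near=> n.
have n0 : (0 : R) < n%:R by rewrite ltr0n; near: n; exists 1%N.
have mU : measurable [set w | eps / 4 * n%:R < H n w] by exact: measurable_gt.
have mVn := measurable_max_exceeds (eps / 2 * n%:R) n
  (fun k => measurable_walk k mV).
apply: (@le_trans _ _ (P (max_exceeds (walk V) (eps / 2 * n%:R) n `|`
    [set w | eps / 4 * n%:R < H n w]))).
  apply: le_measure; rewrite ?inE; [|exact: measurableU|].
    by apply: measurable_max_exceeds => k; exact: measurable_funB.
  move=> w [k kn Wk].
  have [?|HS] := ltP (eps / 4 * n%:R) (H n w); [by right|left].
  exists k => //.
  have decomp : walk X_ k w - k%:R * mu =
      walk V k w - (\sum_(0 <= i < k) (clamp c (X_ i w) - X_ i w)) +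
      k%:R * (m - mu).
    rewrite /walk /V /f !sumrB big_const_nat subn0 iter_addr_0 -mulr_natl.
    ring.
  have h_le : `|\sum_(0 <= i < k) (clamp c (X_ i w) - X_ i w)| <= H n w.
    apply: le_trans (ler_norm_sum _ _ _) _.
    rewrite /H (@big_cat_nat _ _ _ k 0 n)//= lerDl sumr_ge0// => i _.
    exact: normr_ge0.
  have m_le : `|k%:R * (m - mu)| <= eps / 4 * n%:R.
    rewrite normrM normr_nat mulrC ler_pM// ?ler_nat//.
    by rewrite (le_trans m_mu)// ge_min lexx.
  have := ler_normD (walk V k w -
    \sum_(0 <= i < k) (clamp c (X_ i w) - X_ i w)) (k%:R * (m - mu)).
  have := ler_normB (walk V k w) (\sum_(0 <= i < k) (clamp c (X_ i w) - X_ i w)).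
  move: Wk; rewrite decomp; lra.
apply: le_trans (measureU2 _ mVn mU) _.
rewrite [e]splitr EFinD; apply: leeD.
  by apply: VN; near: n; exists N.
apply: le_trans (markov_ge0 P (mH n) _ _) _.
- by move=> w; apply: sumr_ge0 => i _; exact: normr_ge0.
- by rewrite mulr_gt0// divr_gt0.
apply: (@le_trans _ _ ((eps / 4 * n%:R)^-1%:E * (n%:R * delta)%:E)%E).
  by rewrite lee_pmul2l// lte_fin invr_gt0 mulr_gt0// divr_gt0.
rewrite -EFinM lee_fin.
have -> : (eps / 4 * n%:R)^-1 * (n%:R * delta) = 4 / eps * delta.
  by field; rewrite !gt_eqF.
rewrite -ler_pdivlMl ?divr_gt0//.
apply: (@le_trans _ _ (e * eps / 8)); first by rewrite ge_min lexx orbT.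
by rewrite le_eqVlt; apply/orP; left; apply/eqP; field; rewrite gt_eqF.
Unshelve. all: by end_near. Qed.

End maximal_law.

(** * Pathwise description of running maximum and first passage *)

Section pathwise.
Context (T : Type) (R : realType) (xi_ eta_ : nat -> T -> R).
Local Notation M := (running_max xi_ eta_).
Local Notation S := (walk xi_).
Local Notation tau := (first_passage xi_ eta_).

Lemma le_running_maxP (n : nat) (w : T) (a : R) : (0 < n)%N ->
  M n w <= a <->
  forall k, (1 <= k <= n)%N -> perturbed_walk xi_ eta_ k w <= a.
Proof.
move=> n0; split=> [Ma k kn|Ta].
  apply: le_trans Ma; rewrite /running_max.
  apply: (le_bigmax_seq _ k xpredT (perturbed_walk xi_ eta_ ^~ w)) => //.
  by rewrite mem_index_iota ltnS.
rewrite /running_max big_nat; apply: bigmax_le; first exact: Ta.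
by move=> k; rewrite ltnS; exact: Ta.
Qed.

Lemma lt_running_maxP (n : nat) (w : T) (a : R) : (0 < n)%N ->
  a < M n w <->
  exists2 k, (1 <= k <= n)%N & a < perturbed_walk xi_ eta_ k w.
Proof.
move=> n0; split=> [aM|[k kn aT]]; last first.
  by rewrite ltNge; apply/negP => /(le_running_maxP _ _ n0)/(_ k kn); rewrite leNgt aT.
apply: contrapT => noT; move: aM; rewrite ltNge => /negP; apply.
apply/le_running_maxP => // k kn; rewrite leNgt; apply/negP => aT.
by apply: noT; exists k.
Qed.

Lemma lt_first_passageP (t : R) (w : T) (x : \bar R) :
  (tau t w < x)%E <->
  exists2 n, (1 <= n)%N /\ t < perturbed_walk xi_ eta_ n w & (n%:R%:E < x)%E.
Proof.
split=> [/ereal_inf_ltP[_ [n nT <-] nx]|[n nT nx]]; first by exists n.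
by apply/ereal_inf_ltP; exists n%:R%:E => //; exists n.
Qed.

Lemma first_passage_ge1 (t : R) (w : T) : (1%:E <= tau t w)%E.
Proof.
rewrite leNgt; apply/negP => /lt_first_passageP[n [n1 _]].
by rewrite lte_fin ltNge ler1n n1.
Qed.

End pathwise.

Section measurability.
Context d (T : measurableType d) (R : realType).
Context (xi_ eta_ : nat -> T -> R).
Context (mxi : forall k, measurable_fun setT (xi_ k)).
Context (meta : forall k, measurable_fun setT (eta_ k)).

Lemma measurable_perturbed_walk n :
  measurable_fun setT (perturbed_walk xi_ eta_ n).
Proof. by apply: measurable_funD => //; exact: measurable_walk. Qed.

Lemma measurable_running_max n : measurable_fun setT (running_max xi_ eta_ n).
Proof.
rewrite /running_max; elim: (index_iota 1 n.+1) => [|k s IH].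
  under eq_fun do rewrite big_nil; exact: measurable_perturbed_walk.
under eq_fun do rewrite big_cons.
by apply: measurable_maxr => //; exact: measurable_perturbed_walk.
Qed.

(** The preimages of the rays [y < x] are countable unions of events on the
perturbed walk, and these rays generate the measurable sets. *)
Lemma measurable_first_passage t :
  measurable_fun setT (first_passage xi_ eta_ t).
Proof.
move=> mT; apply: (measurability _ (ErealGenInftyO.measurableE R)) => //.
move=> _ [_ [x ->] <-]; rewrite setTI.
rewrite (_ : _ @^-1` _ = \bigcup_(n in [set n | (1 <= n)%N /\ (n%:R%:E < x%:E)%E])
    [set w | t < perturbed_walk xi_ eta_ n w]).
  by apply: bigcup_measurable => n _; apply/measurable_gt/measurable_perturbed_walk.
apply/seteqP; split=> w /=.
  by rewrite in_itv/= => /lt_first_passageP[n [n1 tT] nx]; exists n.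
by move=> [n [n1 nx] tT]; rewrite in_itv/=; apply/lt_first_passageP; exists n.
Qed.

Lemma measurable_first_passage_deviation t a eps :
  measurable [set w |
    (eps%:E < `|(t^-1)%:E * first_passage xi_ eta_ t w - a%:E|)%E].
Proof.
rewrite -[X in measurable X]setTI; apply: emeasurable_fun_o_infty => //.
apply: measurableT_comp => //; apply: emeasurable_funB => //.
by apply: emeasurable_funM => //; exact: measurable_first_passage.
Qed.

Lemma measurable_eta_exceeds n a :
  measurable [set w | exists2 k, (k < n)%N & a < eta_ k w].
Proof.
apply: (@bigcup_measurable _ _ (fun k => [set w | a < eta_ k w]) `I_n).
by move=> k _; exact: measurable_gt.
Qed.

End measurability.

(** * Consequences of the i.i.d. hypothesis *)

(** The form of Bernoulli's inequality that turns a lower bound on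
[(1 - p) ^+ n] into an upper bound on [n p]. *)
Lemma bernoulli_inequality (R : realFieldType) (p : R) (n : nat) :
  0 <= p <= 1 -> (1 - p) ^+ n * (1 + n%:R * p) <= 1.
Proof.
move=> /andP[p0 p1]; elim: n => [|n IH]; first by rewrite expr0 mul0r addr0 mul1r.
apply: le_trans IH; rewrite exprSr -mulrA ler_wpM2l ?exprn_ge0 ?subr_ge0//.
rewrite -natr1; have : 0 <= (n%:R + 1) * p ^+ 2 by rewrite mulr_ge0 ?sqr_ge0.
nra.
Qed.

Section copies.
Context d (T : measurableType d) (R : realType) (P : probability T R).
Context (xi eta : {RV P >-> R}) (xi_ eta_ : nat -> {RV P >-> R}).
Context (Hcopies : independent_copies P
  (fun k w => (xi_ k w, eta_ k w)) (fun w => (xi w, eta w))).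

Lemma xi_same_distribution k : same_distribution P (xi_ k) xi.
Proof.
move=> B mB; have /(_ k (B `*` setT)) := Hcopies.2.
rewrite (_ : _ @^-1` _ = xi_ k @^-1` B); last by apply/seteqP; split=> w // [].
rewrite [in RHS](_ : _ @^-1` _ = xi @^-1` B); last by apply/seteqP; split=> w // [].
by apply; exact: measurableX.
Qed.

Lemma eta_same_distribution k : same_distribution P (eta_ k) eta.
Proof.
move=> B mB; have /(_ k (setT `*` B)) := Hcopies.2.
rewrite (_ : _ @^-1` _ = eta_ k @^-1` B); last by apply/seteqP; split=> w // [].
rewrite [in RHS](_ : _ @^-1` _ = eta @^-1` B); last by apply/seteqP; split=> w // [].
by apply; exact: measurableX.
Qed.

Lemma xi_pairwise_independent i j : i != j ->
  forall A B : set R, measurable A -> measurable B ->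
  P (xi_ i @^-1` A `&` xi_ j @^-1` B) =
  (P (xi_ i @^-1` A) * P (xi_ j @^-1` B))%E.
Proof.
move=> ij A B mA mB.
have := Hcopies.1 [fset i; j]%fset
  (fun k => (if k == i then A else B) `*` setT).
rewrite big_fsetU1 ?inE//= big_seq_fset1 eqxx eq_sym (negbTE ij).
have XE k (C : set R) :
    (fun w => (xi_ k w, eta_ k w)) @^-1` (C `*` setT) = xi_ k @^-1` C.
  by apply/seteqP; split=> w // [].
rewrite !XE => <-; last first.
  by move=> k _; apply: measurableX => //; case: ifP.
congr (P _); apply/seteqP; split=> [w [Aw Bw] k|w Hw].
  by rewrite /= !inE => /orP[]/eqP ->; split=> //=; rewrite ?eqxx// eq_sym (negbTE ij).
split.
  by have /= := Hw i; rewrite !inE eqxx => -[].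
by have /= := Hw j; rewrite !inE eqxx orbT eq_sym (negbTE ij) => -[].
Qed.

Lemma probability_eta_exceeds (n : nat) (a : R) :
  P [set w | exists2 k, (k < n)%N & a < eta_ k w] =
  (1 - (1 - fine (P [set w | (a < eta w)%R])) ^+ n)%:E.
Proof.
have mB : measurable [set x : R | x <= a] by rewrite -set_itvNyc.
have -> : [set w | exists2 k, (k < n)%N & a < eta_ k w] =
    ~` \bigcap_(k in [set` [fset k in iota 0 n]%fset])
       ((fun w => (xi_ k w, eta_ k w)) @^-1` (setT `*` [set x | x <= a])).
  apply/seteqP; split=> w.
    move=> [k kn aw] /(_ k); rewrite /= !inE mem_iota /= add0n kn => -[//|_].
    by rewrite leNgt aw.
  move=> /existsNP[k /not_implyP[]]; rewrite /= !inE mem_iota /= add0n => kn.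
  move=> /not_andP[//|/negP]; rewrite -ltNge => aw.
  by exists k.
rewrite probability_setC; last first.
  apply: fin_bigcap_measurable; first exact: finite_fset.
  move=> k _; rewrite -[X in measurable X]setTI.
  by apply: measurable_fun_pair => //; exact: measurableX.
rewrite (Hcopies.1 _ (fun=> setT `*` [set x | x <= a])); last first.
  by move=> k _; exact: measurableX.
have PE k : P ((fun w => (xi_ k w, eta_ k w)) @^-1` (setT `*` [set x | x <= a])) =
    (1 - fine (P [set w | (a < eta w)%R]))%:E.
  rewrite (_ : _ @^-1` _ = eta_ k @^-1` [set x | x <= a]); last first.
    by apply/seteqP; split=> w // [].
  rewrite eta_same_distribution//.
  rewrite (_ : _ @^-1` _ = ~` [set w | a < eta w]); last first.
    by apply/seteqP; split=> w /=; rewrite leNgt => /negP.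
  rewrite probability_setC; last exact: measurable_gt.
  by rewrite EFinB fineK// fin_num_measure//; exact: measurable_gt.
under eq_bigr do rewrite PE.
by rewrite prodEFin big_const_seq count_predT card_fseq undup_id ?iota_uniq//
  size_iota -EFinB; congr (1 - _)%:E; rewrite -Monoid.iteropE.
Qed.

End copies.

(** * From the running maximum to the tail of the perturbation *)

Section equivalences.
Context d (T : measurableType d) (R : realType) (P : probability T R).
Context (xi eta : {RV P >-> R}) (xi_ eta_ : nat -> {RV P >-> R}).
Context (Hcopies : independent_copies P
  (fun k w => (xi_ k w, eta_ k w)) (fun w => (xi w, eta w))).
Context (mu : R).
Context (Hint : P.-integrable setT (EFin \o xi)).
Context (Hmu : (\int[P]_w (xi w)%:E = mu%:E)%E).
Context (mu_gt0 : 0 < mu).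

Local Notation M := (running_max xi_ eta_).
Local Notation tau := (first_passage xi_ eta_).

Let mxi k : measurable_fun setT (xi_ k). Proof. by []. Qed.
Let meta k : measurable_fun setT (eta_ k). Proof. by []. Qed.
Let mM n : measurable_fun setT (M n).
Proof. exact: measurable_running_max. Qed.
Let mS k : measurable_fun setT (fun w => walk xi_ k w - k%:R * mu).
Proof. by apply: measurable_funB => //; exact: measurable_walk. Qed.

Lemma walk_max_deviation (eps : R) : 0 < eps ->
  P (max_exceeds (fun k w => walk xi_ k w - k%:R * mu) (eps * n%:R) n)
    @[n --> \oo] --> 0%E.
Proof.
move=> eps0; apply: (@maximal_law_of_large_numbers _ _ _ _ xi_ xi) => //.
- by move=> i j; exact: (xi_pairwise_independent Hcopies).
- by move=> i; exact: (xi_same_distribution Hcopies).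
Qed.

(** Any linear bound on [M_n] will do. Since [eta_(k+1) = T_(k+1) - S_k] and the
walk stays above [- mu n], no perturbation among the first [n] exceeds
[D n], [D = C + mu], with high probability; independence and Bernoulli's inequality
turn this into [n P(eta > D n) -> 0]. The passage from the multiples of [D] to all
real [t] costs a factor 2, as [t < D (n + 1) <= 2 D n] for [n] the integer part of
[t / D]. *)
Lemma tail_of_running_max_bound (C : R) : 0 < C ->
    P [set w | C * n%:R < M n w] @[n --> \oo] --> 0%E ->
  (t%:E * P [set w | (t < eta w)%R])%E @[t --> +oo] --> 0%E.
Proof.
move=> C0 PM.
pose D := C + mu.
have D0 : 0 < D by exact: addr_gt0.
have PA : P [set w | exists2 k, (k < n)%N & D * n%:R < eta_ k w]
    @[n --> \oo] --> 0%E.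
  have mA n : measurable [set w | C * n%:R < M n w] by exact: measurable_gt.
  apply: (probability_cvg0_subset _ _ _
    (probability_cvg0_setU mA _ PM (walk_max_deviation mu_gt0))) => [n|n||n].
  - exact: measurable_eta_exceeds.
  - by apply: measurableU => //; exact: measurable_max_exceeds.
  - near=> n => w [k kn etak].
    have [Sk|Sk] := ltP (mu * n%:R) `|walk xi_ k w - k%:R * mu|.
      by right; exists k => //; exact: ltnW.
    left; apply/lt_running_maxP; first exact: leq_ltn_trans kn.
    exists k.+1 => //; rewrite /perturbed_walk /=.
    move: Sk; rewrite ler_norml => /andP[Sk _].
    have : 0 <= k%:R * mu by rewrite mulr_ge0// ltW.
    move: etak; rewrite /D; lra.
  - exact: measurable_max_exceeds.
pose p n := fine (P [set w | (D * n%:R < eta w)%R]).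
have mE a : measurable [set w | a < eta w] by exact: measurable_gt.
have pE n : (P [set w | (D * n%:R < eta w)%R] = (p n)%:E)%E.
  by rewrite fineK// fin_num_measure.
have p0 n : 0 <= p n by rewrite fine_ge0.
have p1 n : p n <= 1 by rewrite -lee_fin -pE probability_le1.
have np e : 0 < e -> \forall n \near \oo, n%:R * p n <= e.
  move=> e0; pose theta := e / (1 + e).
  have e1 : 0 < 1 + e by rewrite addr_gt0.
  have theta0 : 0 < theta by rewrite divr_gt0.
  (* [1 - theta = 1 / (1 + e)], so [1 - (1 - p)^n <= theta] and Bernoulli's
     inequality give [(1 + n p) / (1 + e) <= 1]. *)
  have PA' := (nneg_cvge0P _).1 PA theta theta0.
  near=> n.
  have : (P [set w | exists2 k, (k < n)%N & (D * n%:R < eta_ k w)%R] <= theta%:E)%E.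
    near: n; apply: PA'; apply: nearW => n; exact: measure_ge0.
  rewrite (probability_eta_exceeds Hcopies) lee_fin -/(p n) => q_le.
  have /(bernoulli_inequality n) := introT andP (conj (p0 n) (p1 n)).
  have q_ge : (1 + e)^-1 <= (1 - p n) ^+ n.
    have -> : (1 + e)^-1 = 1 - theta by rewrite /theta; field; rewrite gt_eqF.
    lra.
  have np0 : 0 <= 1 + n%:R * p n by rewrite addr_ge0// mulr_ge0.
  move=> /(le_trans (ler_wpM2r np0 q_ge)).
  by rewrite mulrC ler_pdivrMr// mul1r lerD2l.
apply/nneg_cvge0P => [|e e0].
  near=> t; rewrite mule_ge0// lee_fin; near: t.
  exact: nbhs_pinfty_ge.
have e'0 : 0 < e / (2 * D) by rewrite divr_gt0// mulr_gt0.
have [N _ HN] := np _ e'0.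
near=> t.
have t0 : 0 < t by near: t; exact: nbhs_pinfty_gt.
pose n := Num.truncn (t / D).
have /andP[nt tn] : n%:R <= t / D < n.+1%:R.
  by apply: truncn_itv; rewrite divr_ge0// ltW.
have Nn : (N <= n)%N.
  rewrite /n truncn_ge_nat; last by apply: divr_ge0; exact: ltW.
  rewrite ler_pdivlMr; last exact: D0.
  by near: t; apply: nbhs_pinfty_ge; exact: num_real.
have n1 : 1 <= n%:R :> R.
  rewrite ler1n truncn_gt0 ler_pdivlMr; last exact: D0.
  rewrite mul1r.
  by near: t; apply: nbhs_pinfty_ge; exact: num_real.
have := HN n Nn; rewrite /= ler_pdivlMr ?mulr_gt0// => npe.
apply: (@le_trans _ _ (t%:E * (p n)%:E)%E).
  rewrite lee_pmul2l// -pE; apply: le_measure; rewrite ?inE//.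
  by move=> w /=; apply: le_lt_trans; rewrite mulrC -ler_pdivlMr.
rewrite -EFinM lee_fin; apply: le_trans npe.
have -> : n%:R * p n * (2 * D) = (2 * n%:R * D) * p n by ring.
rewrite ler_wpM2r//; move: tn; rewrite ltr_pdivrMr// -natr1 => tn.
apply: (le_trans (ltW tn)); rewrite ler_pM2r//; lra.
Unshelve. all: by end_near. Qed.

(** * From the tail of the perturbation to the running maximum *)

Section tail_to_max.
Context (W3 : (t%:E * P [set w | (t < eta w)%R])%E @[t --> +oo] --> 0%E).

Lemma eta_max_negligible (a : R) : 0 < a ->
  P [set w | exists2 k, (k < n)%N & a * n%:R < eta_ k w] @[n --> \oo] --> 0%E.
Proof.
move=> a0.
have mE b : measurable [set w | b < eta w] by exact: measurable_gt.
apply/nneg_cvge0P => [|e e0]; first by apply: nearW => n; exact: measure_ge0.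
have ea0 : 0 < e * a by exact: mulr_gt0.
have W3' := (nneg_cvge0P _).1 W3 _ ea0.
have [|K [_ HK]] := W3'.
  near=> t; rewrite mule_ge0// lee_fin; near: t.
  exact: nbhs_pinfty_ge.
near=> n.
have n0 : (0 : R) < n%:R by rewrite ltr0n; near: n; exists 1%N.
have /HK : K < a * n%:R.
  by rewrite -ltr_pdivrMl//; near: n; exact: nbhs_infty_gtr.
set p := P _ => ap.
have pe : (n%:R%:E * p <= e%:E)%E.
  by move: ap; rewrite [a * _]mulrC [e * a]mulrC [n%:R * _]mulrC !EFinM -muleA lee_pmul2l.
apply: le_trans pe.
rewrite (_ : [set w | _] = \big[setU/set0]_(k < n) [set w | a * n%:R < eta_ k w]);
  last by rewrite -(bigcup_mkord n (fun k => [set w | a * n%:R < eta_ k w])).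
apply: (le_trans (@content_subadditive _ _ _ P _
    (fun k => [set w | a * n%:R < eta_ k w]) n _ _ (@subset_refl _ _))).
- by move=> k _; exact: measurable_gt.
- by apply: bigsetU_measurable => k _; exact: measurable_gt.
rewrite (eq_bigr (fun=> p)); last first.
  move=> k _; rewrite -[LHS]/(P (eta_ k @^-1` [set x | a * n%:R < x])).
  apply: (eta_same_distribution Hcopies).
  by rewrite -set_itvoy.
by rewrite -[p]fineK ?fin_num_measure// sumEFin sumr_const card_ord -EFinM mulr_natl.
Unshelve. all: by end_near. Qed.

(** Each [eta_n] has the law of [eta], and [P(eta < - a n) -> 0] holds for any real
random variable. Only this weak control of the negative part is needed, since
the lower bound on the maximum involves a single perturbation. *)
Lemma eta_last_negligible (a : R) : 0 < a ->
  P [set w | eta_ n.-1 w < - (a * n%:R)] @[n --> \oo] --> 0%E.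
Proof.
move=> a0.
have cdf0 : cdf eta (- (a * n%:R)) @[n --> \oo] --> 0%E.
  apply: cvg_comp; last exact: cvg_cdfNy0.
  apply: (cvgNrNy (fun n => a * n%:R)).2; apply/cvgryPge => A.
  by near=> n; rewrite -ler_pdivrMl//; near: n; exact: nbhs_infty_ger.
apply: (squeeze_cvge _ _ cdf0); last exact: cvg_cst.
apply: nearW => n; rewrite measure_ge0/=.
rewrite -[leLHS]/(P (eta_ n.-1 @^-1` [set x | x < - (a * n%:R)])).
rewrite (eta_same_distribution Hcopies); last by rewrite -set_itvNyo.
rewrite /cdf /distribution /pushforward; apply: le_measure; rewrite ?inE.
- by rewrite -[X in measurable X]setTI; apply: (measurable_funP eta) => //; rewrite -set_itvNyo.
- by rewrite -[X in measurable X]setTI; apply: (measurable_funP eta).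
- by move=> w /=; rewrite in_itv/= => /ltW.
Unshelve. all: by end_near. Qed.

(** Above, [M_n <= max_(k < n) S_k + max_(k <= n) eta_k]; below, [M_n >= T_n]. *)
Lemma running_max_law (eps : R) : 0 < eps ->
  P [set w | eps < `|n%:R^-1 * M n w - mu|] @[n --> \oo] --> 0%E.
Proof.
move=> eps0.
have e2 : 0 < eps / 2 by exact: divr_gt0.
have e4 : 0 < eps / 4 by exact: divr_gt0.
have mA n : measurable [set w | exists2 k, (k < n)%N & eps / 2 * n%:R < eta_ k w].
  exact: measurable_eta_exceeds.
have mB n : measurable [set w | eta_ n.-1 w < - (eps / 4 * n%:R)].
  by rewrite -[X in measurable X]setTI -preimage_itvNyo; exact: measurable_funP.
have mV n : measurable (max_exceeds (fun k w => walk xi_ k w - k%:R * mu)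
    (eps / 4 * n%:R) n) by exact: measurable_max_exceeds.
apply: (probability_cvg0_subset _ _ _ (probability_cvg0_setU mV _
  (walk_max_deviation e4) (probability_cvg0_setU mA mB
    (eta_max_negligible e2) (eta_last_negligible e4)))) => [n|n||n].
- by apply: measurable_norm_gt; apply: measurable_funB => //; exact: measurable_funM.
- by apply: measurableU => //; exact: measurableU.
- near=> n => w /= dev.
  have n0 : (0 < n)%N by near: n; exists 1%N.
  have n0R : (0 : R) < n%:R by rewrite ltr0n.
  have mun : mu <= eps / 4 * n%:R.
    by rewrite -ler_pdivrMl//; near: n; exact: nbhs_infty_ger.
  apply: contrapT => /not_orP[noV /not_orP[noA noB]].
  have Sdev k : (k <= n)%N -> `|walk xi_ k w - k%:R * mu| <= eps / 4 * n%:R.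
    by move=> kn; rewrite leNgt; apply/negP => Vk; apply: noV; exists k.
  have lower : (mu - eps) * n%:R <= M n w.
    have : perturbed_walk xi_ eta_ n w <= M n w.
      by apply: (le_running_maxP _ _ _ _ n0).1; rewrite // n0 leqnn.
    apply: le_trans; rewrite /perturbed_walk.
    have := Sdev n.-1 (leq_pred n); rewrite ler_norml => /andP[S1 _].
    have : - (eps / 4 * n%:R) <= eta_ n.-1 w by rewrite leNgt; apply/negP.
    have nE : n.-1%:R = n%:R - 1 :> R by rewrite -[in RHS](prednK n0) -natr1 addrK.
    have : 0 <= eps * n%:R by rewrite mulr_ge0// ltW.
    move: S1 mun; rewrite nE; lra.
  have upper : M n w <= (mu + eps) * n%:R.
    apply/le_running_maxP => // k /andP[k1 kn]; rewrite /perturbed_walk.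
    have k1n : (k.-1 < n)%N by rewrite prednK.
    have := Sdev k.-1 (ltnW k1n); rewrite ler_norml => /andP[_ S1].
    have : eta_ k.-1 w <= eps / 2 * n%:R.
      by rewrite leNgt; apply/negP => Ak; apply: noA; exists k.-1.
    have : k.-1%:R * mu <= n%:R * mu by rewrite ler_pM2r// ler_nat ltnW.
    have : 0 <= eps * n%:R by rewrite mulr_ge0// ltW.
    lra.
  move: dev; rewrite ltNge => /negP; apply.
  rewrite ler_distl mulrC ler_pdivlMr// ler_pdivrMr// lower upper//.
- exact: measurableU.
Unshelve. all: by end_near. Qed.

End tail_to_max.

(** * Running maximum and first passage times *)

Section max_to_passage.
Context (W2 : forall eps : R, 0 < eps ->
  P [set w | eps < `|n%:R^-1 * M n w - mu|] @[n --> \oo] --> 0%E).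

Let max_law_along_truncn (b eps : R) : 0 < b -> 0 < eps ->
  P [set w | eps < `|(Num.truncn (b * t))%:R^-1 * M (Num.truncn (b * t)) w - mu|]
    @[t --> +oo] --> 0%E.
Proof.
move=> b0 eps0; apply: (cvg_comp (fun t : R => Num.truncn (b * t)) _ _ (W2 eps0)).
apply/cvgnyPge => N; near=> t; rewrite truncn_ge_nat; last first.
  by rewrite mulr_ge0 ?ltW//; near: t; exact: nbhs_pinfty_gt.
rewrite mulrC -ler_pdivrMr; last exact: b0.
by near: t; apply: nbhs_pinfty_ge; exact: num_real.
Unshelve. all: by end_near. Qed.

Let mdev (eps : R) n : measurable [set w | eps < `|n%:R^-1 * M n w - mu|].
Proof.
by apply: measurable_norm_gt; apply: measurable_funB => //; exact: measurable_funM.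
Qed.

(** Late passage means [M_n <= t] with [n] the integer part of [(1 / mu + eps) t], so
that [M_n / n] is asymptotically at most [mu / (1 + eps mu) < mu]. *)
Lemma first_passage_not_late (eps : R) : 0 < eps ->
  P [set w | (((mu^-1 + eps) * t)%:E < tau t w)%E] @[t --> +oo] --> 0%E.
Proof.
move=> eps0; pose b := mu^-1 + eps.
have b0 : 0 < b by rewrite addr_gt0// invr_gt0.
(* Half of the available gap: rounding [b t] down to [n] costs an additive
   constant, which the other half absorbs for large [t]. *)
pose eps1 := eps * mu / (2 * b).
have eps10 : 0 < eps1 by rewrite divr_gt0 ?mulr_gt0.
have eps1b : (mu - eps1) * b = 1 + eps * mu / 2.
  have mub : mu * b = 1 + eps * mu by rewrite /b; field; rewrite gt_eqF.
  have -> : eps1 = eps * mu / 2 / b by rewrite /eps1 invfM mulrA.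
  rewrite mulrBl divfK ?gt_eqF// mub; lra.
have mu_eps1 : 0 < mu - eps1.
  rewrite -(pmulr_lgt0 _ b0) eps1b addr_gt0// divr_gt0// mulr_gt0//.
apply: (probability_cvg0_subset _ _ _ (max_law_along_truncn b0 eps10)) => [t|t|].
- rewrite -[X in measurable X]setTI; apply: emeasurable_fun_o_infty => //.
  exact: measurable_first_passage.
- exact: mdev.
near=> t => w /= late.
have t0 : 0 < t by near: t; exact: nbhs_pinfty_gt.
have t_large : 2 / eps < t.
  by near: t; apply: nbhs_pinfty_gt; exact: num_real.
have tb : b^-1 <= t.
  by near: t; apply: nbhs_pinfty_ge; exact: num_real.
set n := Num.truncn (b * t).
have /andP[nbt btn] : n%:R <= b * t < n.+1%:R by apply: truncn_itv; rewrite mulr_ge0// ltW.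
have n0 : (0 < n)%N by rewrite truncn_gt0 -ler_pdivrMl// mulr1.
have n0R : (0 : R) < n%:R by rewrite ltr0n.
have Mt : M n w <= t.
  apply/le_running_maxP => // k /andP[k1 kn]; rewrite leNgt; apply/negP => tT.
  have : (tau t w <= k%:R%:E)%E by apply: ereal_inf_lbound; exists k.
  apply/negP; rewrite -ltNge; apply: le_lt_trans late; rewrite lee_fin.
  by rewrite (le_trans _ nbt)// ler_nat.
have tn : t < (mu - eps1) * n%:R.
  have : (mu - eps1) * (b * t) < (mu - eps1) * n.+1%:R by rewrite ltr_pM2l.
  rewrite mulrA eps1b -[n.+1%:R]natr1.
  have : 2 * mu < t * eps * mu by rewrite ltr_pM2r// -ltr_pdivrMr.
  lra.
rewrite distrC; apply: lt_le_trans (ler_norm _).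
rewrite ltrBrDr addrC -ltrBrDr mulrC ltr_pdivrMr//.
exact: le_lt_trans Mt tn.
Unshelve. all: by end_near. Qed.

(** Early passage means [M_n > t] with [n] the integer part of [(1 / mu - eps) t], so
that [M_n / n] exceeds [mu / (1 - eps mu) > mu]. *)
Lemma first_passage_not_early (eps : R) : 0 < eps ->
  P [set w | (tau t w < ((mu^-1 - eps) * t)%:E)%E] @[t --> +oo] --> 0%E.
Proof.
move=> eps0; pose a := mu^-1 - eps.
have mE t : measurable [set w | (tau t w < (a * t)%:E)%E].
  rewrite -[X in measurable X]setTI; apply: emeasurable_fun_infty_o => //.
  exact: measurable_first_passage.
(* A passage time is at least 1, so it cannot be early when [a <= 0]. *)
have [a0|a0] := leP a 0.
  apply: (probability_cvg0_subset mE (fun=> measurable0)); last first.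
    by rewrite measure0; exact: cvg_cst.
  near=> t => w /= /(le_lt_trans (first_passage_ge1 _ _ _ _)).
  rewrite lte_fin; apply/negP; rewrite -leNgt.
  apply: (@le_trans _ _ 0) => //; apply: (mulr_le0_ge0 a0).
  by near: t; exact: nbhs_pinfty_ge.
(* [mu + eps2 = mu (1 + eps mu)] is a polynomial lower bound for the value
   [1 / a = mu / (1 - eps mu)]. *)
pose eps2 := eps * mu ^+ 2.
have eps20 : 0 < eps2 by rewrite mulr_gt0// exprn_gt0.
have eps2a : (mu + eps2) * a <= 1.
  have -> : (mu + eps2) * a = 1 - (eps * mu) ^+ 2.
    by rewrite /eps2 /a; field; rewrite gt_eqF.
  by rewrite gerBl sqr_ge0.
apply: (probability_cvg0_subset mE _ _ (max_law_along_truncn a0 eps20)) => [t|].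
  exact: mdev.
near=> t => w /= /lt_first_passageP[k [k1 tT]]; rewrite lte_fin => kat.
have t0 : 0 < t by near: t; exact: nbhs_pinfty_gt.
set n := Num.truncn (a * t).
have kn : (k <= n)%N by rewrite truncn_ge_nat ?ltW// mulr_gt0.
have n0 : (0 < n)%N by exact: leq_trans kn.
have n0R : (0 : R) < n%:R by rewrite ltr0n.
have nat_ : n%:R <= a * t.
  by have /andP[] := truncn_itv (ltW (mulr_gt0 a0 t0)).
have tM : t < M n w by apply/lt_running_maxP => //; exists k; rewrite ?k1.
apply: lt_le_trans (ler_norm _); rewrite ltrBrDr addrC mulrC ltr_pdivlMr//.
apply: le_lt_trans tM.
apply: (@le_trans _ _ ((mu + eps2) * (a * t))).
  by rewrite ler_pM2l// addr_gt0.
by rewrite mulrA ger_pMl.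
Unshelve. all: by end_near. Qed.

Lemma first_passage_law :
  cvg_in_probability P (pinfty_nbhs R) (fun t w => ((t^-1)%:E * tau t w)%E)
    (fun=> mu^-1).
Proof.
move=> eps eps0.
have mL t : measurable [set w | (((mu^-1 + eps) * t)%:E < tau t w)%E].
  rewrite -[X in measurable X]setTI; apply: emeasurable_fun_o_infty => //.
  exact: measurable_first_passage.
have mE t : measurable [set w | (tau t w < ((mu^-1 - eps) * t)%:E)%E].
  rewrite -[X in measurable X]setTI; apply: emeasurable_fun_infty_o => //.
  exact: measurable_first_passage.
apply: (probability_cvg0_subset _ _ _ (probability_cvg0_setU mL mE
  (first_passage_not_late eps0) (first_passage_not_early eps0))) => [t|t|].
- exact: measurable_first_passage_deviation.
- exact: measurableU.
near=> t => w /= dev.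
have t0 : 0 < t by near: t; exact: nbhs_pinfty_gt.
apply: contrapT => /not_orP[/negP + /negP]; rewrite -!leNgt.
case: (tau t w) dev => [r| |]//=.
rewrite !lee_fin lte_fin mulrC -ler_pdivrMr// => dev r_le.
rewrite -ler_pdivlMr// => le_r; move: dev; apply/negP.
by rewrite -leNgt ler_distl le_r r_le.
Unshelve. all: by end_near. Qed.

End max_to_passage.

(** If [M_n > 3 mu n] then [tau(3 mu n) <= n], so [tau(t) / t <= 1 / (3 mu)] at
[t = 3 mu n], which is further than [1 / (2 mu)] from [1 / mu]. *)
Lemma running_max_bound_of_passage_law :
  cvg_in_probability P (pinfty_nbhs R) (fun t w => ((t^-1)%:E * tau t w)%E)
    (fun=> mu^-1) ->
  P [set w | 3 * mu * n%:R < M n w] @[n --> \oo] --> 0%E.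
Proof.
move=> W1.
have eps0 : 0 < (2 * mu)^-1 by rewrite invr_gt0 mulr_gt0.
have to_oo : (3 * mu * n%:R : R) @[n --> \oo] --> +oo.
  apply/cvgryPge => A; near=> n; rewrite -ler_pdivrMl ?mulr_gt0//.
  by near: n; exact: nbhs_infty_ger.
apply: (probability_cvg0_subset _ _ _ (cvg_comp _ _ to_oo (W1 _ eps0))) => [n|n|].
- exact: measurable_gt.
- exact: measurable_first_passage_deviation.
near=> n => w /= MC.
have n0 : (0 < n)%N by near: n; exists 1%N.
have n0R : (0 : R) < n%:R by rewrite ltr0n.
have [k /andP[k1 kn] tT] := (lt_running_maxP _ _ _ _ n0).1 MC.
have tau_le : (tau (3 * mu * n%:R) w <= n%:R%:E)%E.
  apply: (@le_trans _ _ k%:R%:E); last by rewrite lee_fin ler_nat.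
  by apply: ereal_inf_lbound; exists k.
have := first_passage_ge1 xi_ eta_ (3 * mu * n%:R) w.
case: (tau _ w) tau_le => [r| |]//; rewrite !lee_fin => rn r1.
rewrite -EFinM -EFinB abse_EFin lte_fin distrC; apply: lt_le_trans (ler_norm _).
have : (3 * mu * n%:R)^-1 * r <= (3 * mu)^-1.
  by rewrite ler_pdivrMl ?mulr_gt0// mulrAC divff ?mul1r// gt_eqF// mulr_gt0.
have -> : (3 * mu)^-1 = mu^-1 / 3 by field; rewrite gt_eqF.
have -> : (2 * mu)^-1 = mu^-1 / 2 by field; rewrite gt_eqF.
have : 0 < mu^-1 by rewrite invr_gt0.
lra.
Unshelve. all: by end_near. Qed.

End equivalences.

Theorem theorem2p1 (d : measure_display) (Omega : measurableType d)
    (R : realType) (P : probability Omega R)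
    (xi eta : {RV P >-> R}) (xi_ eta_ : nat -> {RV P >-> R})
    (Hcopies : independent_copies P
       (fun k w => (xi_ k w, eta_ k w)) (fun w => (xi w, eta w)))
    (mu : R) (Hint : (xi : Omega -> R) \in Lfun P 1%E)
    (Hmu : 'E_P[xi]%E = mu%:E) (mu_gt0 : 0 < mu) :
  let W1 := cvg_in_probability P (pinfty_nbhs R)
    (fun t w => ((t^-1)%:E * first_passage xi_ eta_ t w)%E)
    (fun=> mu^-1) in
  let W2 := cvg_in_probability P \oo
    (fun n w => (n%:R^-1 * running_max xi_ eta_ n w)%:E)
    (fun=> mu) in
  let W3 := (t%:E * P [set w | (t < eta w)%R])%E @[t --> +oo] --> 0%E in
  (W1 <-> W2) /\ (W2 <-> W3).
Proof.
move=> W1 W2 W3.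
have iX : P.-integrable setT (EFin \o xi) by exact/Lfun1_integrable.
have EX : (\int[P]_w (xi w)%:E = mu%:E)%E by rewrite -expectation_def.
have W31 : W1 -> W3.
  move=> /(running_max_bound_of_passage_law mu_gt0).
  apply: (tail_of_running_max_bound Hcopies iX EX mu_gt0).
  by rewrite mulr_gt0.
have W23 : W3 -> W2 := running_max_law Hcopies iX EX mu_gt0.
have W12 : W2 -> W1 := first_passage_law mu_gt0.
by split; split => // W; [apply/W23/W31|apply/W31/W12].
Qed.
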